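(* In the first-method model ($F\subset\mathbb R^d$ satisfying (A1)–(A3), $\beta=(\beta_0,\dots,\beta_d,s)^\top$ with $\beta_k=\log|\mathcal C_k(F)|$, observations $y_{kj}=\beta_k+sx_j+\delta_{kj}$, $k=0,\dots,d$, $x_j=-\log\varepsilon_j$ for strictly decreasing radii $\varepsilon_j>0$), let $X_n\in\mathbb R^{n(d+1)\times(d+2)}$ be the design matrix whose row corresponding to $(j,k)$ is $(e_k^\top, x_j)$ with $e_k\in\mathbb R^{d+1}$ the $k$-th unit vector, and let $\hat\beta^{(n)}=(X_n^\top X_n)^{-1}X_n^\top y^{(n)}$ be the least squares estimator. Assume the error vector is $\delta^{(n)}=\sigma\gamma^{(n)}$ with $\sigma>0$ and $\gamma^{(n)}$ having i.i.d. coordinates (common distribution) of mean $0$ and variance $1$, so $Q_n=\sigma^2I$. Suppose there are constants $\gamma,\mu\ge0$ with $\max\{\mu,2\mu-\gamma\}<1$ such that $\widetilde S_n^2=\Theta(n^\gamma)$ and $x_n=O(n^{\mu/2})$ as $n\to\infty$. Then for each $t\in\mathbb R^{d+2}\setminus\{0\}$, $$\frac{t^\top(\hat\beta^{(n)}-\beta)}{\sigma\sqrt{t^\top(X_n^\top X_n)^{-1}t}}\xrightarrow{d}Z\sim\mathcal N(0,1)\quad(n\to\infty).$$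
   Context: (A1): the curvature measures of the parallel sets $F_\varepsilon$ are well defined for a.e. $\varepsilon>0$; (A2): each total curvature $C_k(F_\varepsilon)$ has constant strict sign in $\varepsilon$; (A3): the fractal curvatures $\mathcal C_k(F)=\operatorname{ess\,lim}_{\varepsilon\searrow0}\varepsilon^{s-k}C_k(F_\varepsilon)$ exist, $s$ the Minkowski dimension. $y^{(n)}$ stacks $y_{01},\dots,y_{d1},\dots,y_{0n},\dots,y_{dn}$. $\bar x_n,\widetilde S_n^2$ are the empirical mean and $1/n$-normalized variance of $x_1,\dots,x_n$. *)

(* Defs.v *)
From HB Require Import structures.
From mathcomp Require Import all_boot all_order all_algebra.
From mathcomp Require Import all_classical all_reals all_analysis.
Unset Printing Implicit Defensive.
Import Order.TTheory GRing.Theory Num.Theory.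
Local Open Scope classical_set_scope.
Local Open Scope ring_scope.

Definition mutually_independent {d} {T : measurableType d} {R : realType}
  (P : probability T R) (X : nat -> T -> R) : Prop :=
  forall (s : seq nat) (B : nat -> set R),
    uniq s -> (forall i, measurable (B i)) ->
    P (\big[setI/setT]_(i <- s) (X i @^-1` B i)) =
    (\prod_(i <- s) P (X i @^-1` B i))%E.

Definition identically_distributed {d} {T : measurableType d} {R : realType}
  (P : probability T R) (X : nat -> T -> R) : Prop :=
  forall i (B : set R), measurable B -> P (X i @^-1` B) = P (X 0 @^-1` B).

(** Design points x_j = - log eps_j  (1-based: j = 1, 2, ...). *)
Definition design_x {R : realType} (eps : nat -> R) (j : nat) : R := - ln (eps j).

Definition emp_mean {R : realType} (x : nat -> R) (n : nat) : R :=
  n%:R^-1 * \sum_(1 <= j < n.+1) x j.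
Definition emp_var {R : realType} (x : nat -> R) (n : nat) : R :=
  n%:R^-1 * \sum_(1 <= j < n.+1) (x j - emp_mean x n) ^+ 2.

(** Design matrix X_n in R^{n(d+1) x (d+2)}.  Row index i corresponds to the
    pair (j,k) with j = i %/ (d+1) + 1 (1-based), k = i %% (d+1), matching the
    stacking y_{01},...,y_{d1},...,y_{0n},...,y_{dn}; the row is (e_k^T, x_j). *)
Definition design_matrix {R : realType} (d n : nat) (x : nat -> R)
  : 'M[R]_(n * d.+1, d.+2) :=
  \matrix_(i, c) (if (c < d.+1)%N then ((c : nat) == (i %% d.+1)%N)%:R
                  else x ((i %/ d.+1)%N).+1).

(** Observation vector y^(n): y_{kj} = beta_k + s x_j + delta_{kj} with
    delta = sigma * gamma (gamma indexed along the stacking order),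
    beta = (beta_0,...,beta_d, s)^T. *)
Definition obs_vector {R : realType} {T : Type} (d n : nat) (x : nat -> R)
  (beta : 'cV[R]_(d.+2)) (sigma : R) (gamma : nat -> T -> R) (w : T)
  : 'cV[R]_(n * d.+1) :=
  \col_i (beta (inord ((i %% d.+1)%N)) 0 + beta ord_max 0 * x ((i %/ d.+1)%N).+1
          + sigma * gamma i w).

Definition lse {R : realType} {T : Type} (d n : nat) (x : nat -> R)
  (beta : 'cV[R]_(d.+2)) (sigma : R) (gamma : nat -> T -> R) (w : T)
  : 'cV[R]_(d.+2) :=
  let X := design_matrix d n x in
  invmx (X^T *m X) *m X^T *m obs_vector d n x beta sigma gamma w.

Definition std_stat {R : realType} {T : Type} (d n : nat) (x : nat -> R)
  (beta : 'cV[R]_(d.+2)) (sigma : R) (gamma : nat -> T -> R)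
  (t : 'cV[R]_(d.+2)) (w : T) : R :=
  let X := design_matrix d n x in
  (t^T *m (lse d n x beta sigma gamma w - beta)) 0 0 /
  (sigma * Num.sqrt ((t^T *m invmx (X^T *m X) *m t) 0 0)).

(** Convergence in distribution of (Z_n) to N(0,1): since the N(0,1) cdf is
    continuous, this is pointwise convergence of cdfs at every x. *)
Definition cvg_dist_std_normal {d} {T : measurableType d} {R : realType}
  (P : probability T R) (Z : nat -> T -> R) : Prop :=
  forall r : R,
    (fun n => P [set w | Z n w <= r]) @ \oo --> normal_prob 0 1 `]-oo, r].

(* Main.v *)
Require Import Defs.
From HB Require Import structures.
From mathcomp Require Import all_boot all_order all_algebra.
From mathcomp Require Import all_classical all_reals all_analysis.
From mathcomp Require Import measurable_realfun ring lra.
Import Order.TTheory GRing.Theory Num.Theory.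
Import numFieldNormedType.Exports.
Local Open Scope classical_set_scope.
Local Open Scope ring_scope.

(* With M = X^T X, u = M^-1 t and v = X u, the statistic is the weighted sum
   of the gamma_i with weights v_i / |v|.  The v_i are affine in the design
   points, so |v|^2 splits into n (u_k + s mean)^2 + n s^2 var (s the slope
   entry of u), summed over k; hence v_i^2 / |v|^2 is at most
   2 (1 + D^2 / var) / n with D a bound on the deviations from the mean, and
   this is O(n^(mu - 1)).

   The central limit theorem for weights of unit square sum and vanishing
   maximum is Lindeberg's replacement argument, run without Gaussian random
   variables: u(s, x) = Phi ((r - x) / sqrt s) solves u_s = u_xx / 2, so
   adding an independent summand of variance a^2 to x while lowering s by a^2
   changes the expectation of u only by third-order terms.  Telescoping gives
   E Phi ((r - S) / delta) ~ Phi (r / sqrt (1 + delta^2)), and delta -> 0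
   recovers the distribution function of S. *)

(** * Taylor remainders with explicit bounds *)

Section taylor.
Context {R : realType}.

(** The intermediate point is located by its distance to [a], so later uses need no case split on
    the sign of [b - a]. *)
Lemma mvt_dist (f df : R -> R) (a b : R) :
  (forall x : R, is_derive x 1 f (df x)) ->
  exists2 c, `|c - a| <= `|b - a| & f b - f a = df c * (b - a).
Proof.
move=> fd.
have fc : continuous f.
  by move=> x; apply/differentiable_continuous/derivable1_diffP; case: (fd x).
have [ab|ba] := leP a b.
  have [c] := @MVT_segment R f df a b ab (fun x _ => fd x) (continuous_subspaceT fc).
  rewrite in_itv /= => /andP[ac cb] E; exists c => //.
  by rewrite !ger0_norm ?subr_ge0// lerB.
have [c] := @MVT_segment R f df b a (ltW ba) (fun x _ => fd x) (continuous_subspaceT fc).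
rewrite in_itv /= => /andP[bc ca] E; exists c.
  by rewrite (distrC c) (distrC b) !ger0_norm ?subr_ge0// ?(ltW ba)// lerB.
by rewrite -opprB E -mulrN opprB.
Qed.

(** Two mean value steps give [B] instead of the sharp [B / 2]; only the order in [h] matters. *)
Lemma taylor1_bound (f df ddf : R -> R) (B : R) (x h : R) :
  (forall x : R, is_derive x 1 f (df x)) -> (forall x : R, is_derive x 1 df (ddf x)) ->
  (forall x, `|ddf x| <= B) ->
  `|f (x + h) - f x - df x * h| <= B * h ^+ 2.
Proof.
move=> fd fdd fB.
have [c] := mvt_dist f df x (x + h) fd.
have -> : x + h - x = h by ring.
move=> cx ->; have [e _] := mvt_dist df ddf x c fdd.
move=> /(canRL (subrK _)) ->.
rewrite mulrDl addrK normrM normrM -mulrA -real_normK ?num_real// expr2.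
by apply: ler_pM => //; apply: ler_pM.
Qed.

(** The remainder is cubic for small [h] and quadratic for large [h]. Keeping both bounds in one
    minimum lets Lindeberg's argument run with second moments only. The mean value theorem is
    applied to the remainder [g] as a function of the increment, then to [df]. *)
Lemma taylor2_bound (f df ddf : R -> R) (B L : R) (x h : R) :
  (forall x : R, is_derive x 1 f (df x)) -> (forall x : R, is_derive x 1 df (ddf x)) ->
  (forall x, `|ddf x| <= B) ->
  (forall x y, `|ddf x - ddf y| <= L * `|x - y|) ->
  0 <= L ->
  `|f (x + h) - f x - df x * h - ddf x / 2 * h ^+ 2| <=
   h ^+ 2 * Num.min (2 * B) (L * `|h|).
Proof.
move=> fd fdd fB fL L0.
pose g k := f (x + k) - df x * k - ddf x / 2 * k ^+ 2.
pose dg k := df (x + k) - df x - ddf x * k.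
have gd (k : R) : is_derive k 1 g (dg k).
  rewrite /g /dg.
  have fxd : is_derive k 1 (fun k => f (x + k)) (df (x + k)).
    have xd : is_derive k 1 (fun k : R => x + k) 1.
      by apply: is_derive_eq; rewrite add0r mulr1.
    by have := @is_derive1_comp _ f _ k _ _ (fd (x + k)) xd; rewrite mulr1.
  by apply: is_derive_eq; rewrite /GRing.scale /=; field.
have [c] := mvt_dist g dg 0 h gd.
rewrite !subr0 => ch E.
have -> : f (x + h) - f x - df x * h - ddf x / 2 * h ^+ 2 = dg c * h.
  by rewrite -E /g addr0; ring.
have [e] := mvt_dist df ddf x (x + c) fdd.
have -> : x + c - x = c by ring.
move=> ec E2; rewrite /dg E2 -mulrBl !normrM -mulrA.
rewrite -[h ^+ 2]real_normK ?num_real// expr2 mulrC.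
have B2 : `|ddf e - ddf x| <= 2 * B.
  by rewrite (le_trans (ler_normB _ _))// mulr_natl mulr2n lerD.
have L2 : `|ddf e - ddf x| <= L * `|h|.
  by apply: le_trans (fL _ _) _; rewrite ler_wpM2l// (le_trans ec).
apply: ler_pM => //; first by apply: ler_pM.
by rewrite le_min B2 L2.
Qed.

End taylor.

(** * The standard normal density and distribution function *)

Section gauss.
Context {R : realType}.

Definition gauss (x : R) : R := normal_peak 1 * expR (- x ^+ 2 / 2).

Lemma normal_pdf01 : normal_pdf 0 1 = gauss.
Proof.
rewrite normal_pdfE ?oner_neq0//; apply/funext => x.
by rewrite /normal_fun subr0 expr1n.
Qed.

Lemma gauss_ge0 x : 0 <= gauss x.
Proof. by rewrite mulr_ge0 ?normal_peak_ge0 ?expR_ge0. Qed.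

Lemma normal_peak1_le1 : normal_peak 1 <= 1 :> R.
Proof.
rewrite /normal_peak invf_le1 ?sqrtr_gt0; last first.
  by rewrite expr1n mul1r mulrn_wgt0// pi_gt0.
rewrite -[leLHS]sqrtr1 ler_wsqrtr// expr1n mul1r.
by have := pi_ge2 R; rewrite mulr2n; lra.
Qed.

(** Squaring [1 + x ^+ 2 / 4 <= expR (x ^+ 2 / 4)] shows that the exponential beats a quartic. This
    suffices to bound the cubic polynomial factors met in the derivatives of [Phi]. *)
Lemma gauss_decay x : gauss x * (1 + x ^+ 2 / 4) ^+ 2 <= 1.
Proof.
have e1 : 1 + x ^+ 2 / 4 <= expR (x ^+ 2 / 4) by exact: expR_ge1Dx.
have h0 : 0 <= 1 + x ^+ 2 / 4.
  by rewrite addr_ge0// divr_ge0// sqr_ge0.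
have e2 : (1 + x ^+ 2 / 4) ^+ 2 <= expR (x ^+ 2 / 2).
  apply: le_trans (_ : expR (x ^+ 2 / 4) ^+ 2 <= _).
    by rewrite lerXn2r// nnegrE// ?expR_ge0.
  by rewrite -expRM_natl ler_expR; lra.
apply: le_trans (_ : gauss x * expR (x ^+ 2 / 2) <= _).
  by rewrite ler_wpM2l ?gauss_ge0.
rewrite /gauss -mulrA -expRD mulNr addNr expR0 mulr1.
exact: normal_peak1_le1.
Qed.

Lemma gauss_dominates (x p C : R) : `|p| <= C * (1 + x ^+ 2 / 4) ^+ 2 -> 0 <= C ->
  `|p * gauss x| <= C.
Proof.
move=> pC C0; rewrite normrM (ger0_norm (gauss_ge0 x)).
apply: le_trans (_ : C * (1 + x ^+ 2 / 4) ^+ 2 * gauss x <= _).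
  by rewrite ler_wpM2r ?gauss_ge0.
by rewrite -mulrA ler_piMr// mulrC gauss_decay.
Qed.

Lemma gauss_bound1 x : `|x * gauss x| <= 2.
Proof. by apply: gauss_dominates => //; rewrite ler_norml; nra. Qed.

Lemma gauss_bound2 x : `|(1 - x ^+ 2) * gauss x| <= 4.
Proof. by apply: gauss_dominates => //; rewrite ler_norml; nra. Qed.

Lemma gauss_bound3 x : `|x * (1 - x ^+ 2) * gauss x| <= 16.
Proof.
apply: gauss_dominates => //; rewrite ler_norml; apply/andP; split; nra.
Qed.

Lemma is_derive_gauss (x : R) : is_derive x 1 gauss (- (x * gauss x)).
Proof.
rewrite /gauss.
have h1 : is_derive x 1 (fun x : R => - x ^+ 2 / 2) (- x).
  by apply: is_derive_eq; rewrite /GRing.scale /=; field.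
have h2 := @is_derive1_comp R expR _ x _ _ (is_derive_expR _) h1.
have := @is_deriveZ _ _ _ _ (normal_peak 1) _ _ _ h2.
set f := _ \*: _; rewrite (_ : f = (fun x => normal_peak 1 * expR (- x ^+ 2 / 2))) //.
by move=> h; apply: is_derive_eq; rewrite /GRing.scale /=; ring.
Qed.

Lemma is_derive_xgauss (x : R) : is_derive x 1 (fun x => x * gauss x) ((1 - x ^+ 2) * gauss x).
Proof.
have h := is_derive_gauss x.
by apply: is_derive_eq; rewrite /GRing.scale /=; ring.
Qed.

(** Real-valued, so that it can be differentiated; [PhiE] returns to the extended reals. *)
Definition Phi (x : R) : R := fine (normal_prob 0 1 `]-oo, x]).

Lemma is_derive_Phi (x : R) : is_derive x 1 Phi (gauss x).
Proof.
(* The fundamental theorem is applied on the half-line up to [x + 1], which makes [x] an interior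
   point. *)
have xx1 : x < x + 1 by rewrite ltrDl.
have ig : lebesgue_measure.-integrable [set` Interval -oo%O (BRight (x + 1))]
    (EFin \o gauss).
  rewrite -normal_pdf01.
  by apply: integrableS (@integrable_normal_pdf R 0 1) => //=; exact: measurable_itv.
have cg : {for x, continuous gauss}.
  by rewrite -normal_pdf01; apply: continuous_normal_pdf; rewrite oner_neq0.
have [h1 h2] := @continuous_FTC1 R gauss -oo%O x (x + 1) xx1 ig (ltNyr _) cg.
rewrite /Phi /normal_prob normal_pdf01.
by split => //; rewrite -derive1E h2.
Qed.

Lemma PhiE x : (Phi x)%:E = normal_prob 0 1 `]-oo, x].
Proof. by rewrite /Phi fineK// fin_num_measure//; exact: measurable_itv. Qed.

Lemma Phi_ge0 x : 0 <= Phi x.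
Proof. by rewrite -lee_fin PhiE. Qed.

Lemma Phi_le1 x : Phi x <= 1.
Proof. by rewrite -lee_fin PhiE probability_le1//; exact: measurable_itv. Qed.

Lemma Phi_nondecreasing : {homo Phi : x y / x <= y}.
Proof.
move=> x y xy; rewrite -lee_fin !PhiE le_measure ?inE//; try exact: measurable_itv.
by apply: subset_itvl; rewrite bnd_simp.
Qed.

Lemma continuous_Phi : continuous Phi.
Proof.
move=> x; apply/differentiable_continuous/derivable1_diffP.
by case: (is_derive_Phi x).
Qed.

Lemma measurable_Phi : measurable_fun setT Phi.
Proof. by apply: continuous_measurable_fun; exact: continuous_Phi. Qed.

(** Under the standard normal law on the line, the identity is a random variable with distribution
    function [Phi]. The limits of [Phi] at both infinities are then those of any [cdf]. *)
Let idR : measurableTypeR R -> R := idfun.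
#[local] HB.instance Definition _ :=
  @isMeasurableFun.Build _ _ _ _ idR (@measurable_id _ _ setT).

Let PhiEcdf : EFin \o Phi = cdf (idR : {RV (normal_prob 0 1) >-> R}).
Proof. by apply/funext => x; rewrite /= PhiE. Qed.

Lemma cvg_Phiy : Phi x @[x --> +oo] --> (1 : R).
Proof.
have := cvg_cdfy1 (idR : {RV (normal_prob 0 1) >-> R}).
by rewrite -PhiEcdf => /fine_cvgP[].
Qed.

Lemma cvg_PhiNy : Phi x @[x --> -oo] --> (0 : R).
Proof.
have := cvg_cdfNy0 (idR : {RV (normal_prob 0 1) >-> R}).
by rewrite -PhiEcdf => /fine_cvgP[].
Qed.

Lemma Phi_taylor (y k : R) :
  `|Phi (y + k) - Phi y - gauss y * k + y * gauss y / 2 * k ^+ 2| <=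
    4 * (k ^+ 2 * Num.min 1 `|k|).
Proof.
have gL x z : `|- (x * gauss x) - - (z * gauss z)| <= 4 * `|x - z|.
  rewrite opprK addrC.
  have [c _ ->] := mvt_dist _ _ x z is_derive_xgauss.
  rewrite normrM distrC ler_wpM2r//; exact: gauss_bound2.
have gB x : `|- (x * gauss x)| <= 2 by rewrite normrN gauss_bound1.
have := @taylor2_bound R Phi gauss (fun x => - (x * gauss x)) 2 4 y k
  is_derive_Phi is_derive_gauss gB gL (ler0n _ _).
rewrite !mulNr opprK => /le_trans; apply.
by rewrite mulrCA ler_wpM2l ?sqr_ge0// minr_pMr// mulr1 -natrM.
Qed.

(** This is the time half of the heat equation: the first-order term in [v] equals the second-order
    space term of [Phi_taylor]. With [w = ln (1 + v)] the argument becomes [y * expR (- w / 2)],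
    whose derivative in [w] is minus half itself. Hence the second derivative is a polynomial in the
    argument times [gauss], bounded uniformly in [y]. *)
Lemma Phi_scale_taylor (y v : R) : 0 <= v ->
  `|Phi (y / Num.sqrt (1 + v)) - Phi y + y * gauss y / 2 * v| <= 17 * v ^+ 2.
Proof.
move=> v0.
have v1 : 0 < 1 + v by rewrite ltr_wpDr.
pose w := ln (1 + v).
have ew : y / Num.sqrt (1 + v) = y * expR (- w / 2).
  congr (_ * _); apply/eqP.
  rewrite -(@eqrXn2 _ 2)// ?invr_ge0 ?sqrtr_ge0 ?expR_ge0//.
  rewrite exprVn sqr_sqrtr ?(ltW v1)// -expRM_natl.
  have -> : 2%:R * (- w / 2) = - w by field.
  by rewrite expRN lnK.
have wv : w <= v by rewrite /w le_ln1Dx// (lt_le_trans _ v0)// ltrN10.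
have w0 : 0 <= w by rewrite ln_ge0// lerDl.
(* Applying [ln (1 + h) <= h] to [h = (1 + v)^-1 - 1] gives [v - w <= v ^+ 2 / (1 + v)]. *)
have vw : v - w <= v ^+ 2.
  have := @le_ln1Dx R ((1 + v)^-1 - 1).
  rewrite addrCA subrr addr0 ltrBrDl subrr invr_gt0 => /(_ v1).
  rewrite lnV ?posrE// -/w => h.
  suff : (1 + v)^-1 - 1 <= v ^+ 2 - v by lra.
  rewrite -(ler_pM2r v1) mulrBl mulVf ?gt_eqF//; nra.
pose H k := Phi (y * expR (- k / 2)).
pose z k := y * expR (- k / 2).
have zd (k : R) : is_derive k 1 z (- z k / 2).
  have h1 : is_derive k 1 (fun k : R => - k / 2) (- 2^-1).
    by apply: is_derive_eq; rewrite /GRing.scale /=; field.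
  have h2 := @is_derive1_comp R expR _ k _ _ (is_derive_expR _) h1.
  have := @is_deriveZ _ _ _ _ y _ _ _ h2.
  by move=> h; apply: is_derive_eq; rewrite /z /GRing.scale /=; field.
have Hd (k : R) : is_derive k 1 H (- (z k * gauss (z k)) / 2).
  have := @is_derive1_comp R Phi z k _ _ (is_derive_Phi _) (zd k).
  by move=> h; apply: is_derive_eq; field.
have Hdd (k : R) : is_derive k 1 (fun k => - (z k * gauss (z k)) / 2)
    (z k * (1 - z k ^+ 2) * gauss (z k) / 4).
  have h := @is_derive1_comp R (fun x => x * gauss x) z k _ _
    (is_derive_xgauss _) (zd k).
  have := @is_deriveZ _ _ _ _ (- 2^-1) _ _ _ h.
  set f := (X in is_derive _ _ X _).
  rewrite (_ : f = (fun k => - (z k * gauss (z k)) / 2)); last first.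
    by apply/funext => x; rewrite /f /= /GRing.scale /=; field.
  by move=> {}h; apply: is_derive_eq; rewrite /GRing.scale /=; field.
have HB k : `|z k * (1 - z k ^+ 2) * gauss (z k) / 4| <= 16.
  rewrite normrM (ger0_norm (_ : 0 <= 4^-1)) ?invr_ge0//.
  by have := gauss_bound3 (z k); lra.
have := @taylor1_bound R H _ _ 16 0 w Hd Hdd HB.
rewrite add0r /H -ew /z oppr0 mul0r expR0 mulr1.
set A := Phi _ - _; set b := y * gauss y.
have bb : `|b| <= 2 by exact: gauss_bound1.
move=> h.
(* The constant 17 is 16 from the expansion in [w] plus 1 from exchanging [w] for [v]. *)
have -> : A + b / 2 * v = (A - - b / 2 * w) + b / 2 * (v - w) by ring.
apply: le_trans (ler_normD _ _) _.
have -> : 17 * v ^+ 2 = 16 * v ^+ 2 + 1 * v ^+ 2 by ring.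
apply: lerD.
  by apply: le_trans h _; rewrite ler_wpM2l// lerXn2r.
rewrite normrM ler_pM//.
  by rewrite normrM (ger0_norm (_ : 0 <= 2^-1)) ?invr_ge0//; lra.
by rewrite ger0_norm ?subr_ge0.
Qed.

End gauss.

(** * Consequences of independence and of equal laws for integrals *)

Section independence.
Context {d} {T : measurableType d} {R : realType} (P : probability T R).

(** Factorization on rectangles identifies the joint law with the product of the marginals, by
    uniqueness of the product measure; Tonelli then separates the variables. *)
Lemma ge0_integral_independent {d1 d2} {T1 : measurableType d1}
    {T2 : measurableType d2} (X : {RV P >-> T1}) (Y : {RV P >-> T2})
    (f : T1 * T2 -> \bar R) :
  (forall A B, measurable A -> measurable B ->
     P (X @^-1` A `&` Y @^-1` B) = (P (X @^-1` A) * P (Y @^-1` B))%E) ->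
  measurable_fun setT f -> (forall z, 0 <= f z)%E ->
  (\int[P]_w f (X w, Y w) = \int[P]_w \int[P]_v f (X w, Y v))%E.
Proof.
move=> indep mf f0.
pose XY w := (X w, Y w).
have mXY : measurable_fun setT XY by exact: measurable_fun_pair.
pose XYm := mfun_Sub (mem_set mXY : XY \in mfun).
have -> : (\int[P]_w f (X w, Y w) = \int[distribution P XYm]_z f z)%E.
  by rewrite ge0_integral_pushforward.
rewrite (@eq_measure_integral _ _ _ _
  (distribution P X \x distribution P Y)%E); last first.
  move=> A mA _; apply/esym; apply: product_measure_unique => //.
rewrite fubini_tonelli1// ge0_integral_pushforward//=; last 2 first.
- exact: measurable_fun_fubini_tonelli_F.
- by move=> x _; apply: integral_ge0.
apply: eq_integral => w _ /=.
rewrite /fubini_F ge0_integral_pushforward//.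
by apply: measurableT_comp => //; exact: measurable_pair1.
Qed.

(** A pi-system argument. The cylinders over the first [k] variables are closed under intersection
    and generate a sigma-algebra making [S] measurable. On them the finite measures
    [C |-> P (C & {g k in B})] and [C |-> P (g k in B) * P C] agree by mutual independence, hence
    they agree on the whole sigma-algebra. *)
Lemma independent_sum (g : nat -> {RV P >-> R}) (a : nat -> R) (k : nat)
    (A B : set R) :
  mutually_independent P (fun i => g i : T -> R) ->
  measurable A -> measurable B ->
  let S := fun w => \sum_(0 <= i < k) a i * g i w in
  P (S @^-1` A `&` g k @^-1` B) = (P (S @^-1` A) * P (g k @^-1` B))%E.
Proof.
move=> indep mA mB S.
have mg i (C : set R) : measurable C -> measurable (g i @^-1` C).
  by move=> mC; rewrite -[X in measurable X]setTI; exact: measurable_funP.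
pose cyl (C : nat -> set R) := \big[setI/setT]_(i <- index_iota 0 k) (g i @^-1` C i).
pose G := [set cyl C | C in [set C | forall i, measurable (C i)]].
have Gm : G `<=` measurable.
  move=> _ [C mC <-]; rewrite /cyl; apply: big_ind => //.
    exact: measurableI.
  by move=> i _; exact: mg.
have GT : G setT.
  exists (fun=> setT) => //; rewrite /cyl big1// => i _; exact: preimage_setT.
have GI : setI_closed G.
  move=> _ _ [C mC <-] [D mD <-]; exists (fun i => C i `&` D i).
    by move=> i; apply: measurableI; [exact: mC|exact: mD].
  by rewrite /cyl -big_split/=; apply: eq_bigr => i _; rewrite preimage_setI.
have mgG i : (i < k)%N ->
    measurable_fun setT (g i : g_sigma_algebraType G -> R).
  move=> ik _ C mC; rewrite setTI; apply: sub_sigma_algebra.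
  (* The event that only constrains the [i]-th variable is the cylinder with full sides
     elsewhere. *)
  exists (fun j => if j == i then C else setT) => [j /=|].
    by case: ifP.
  rewrite /cyl (bigD1_seq i)/= ?iota_uniq ?mem_index_iota// eqxx big1 ?setIT//.
  by move=> j /negbTE ->; exact: preimage_setT.
have mS : measurable_fun setT (S : g_sigma_algebraType G -> R).
  rewrite /S; under eq_fun do rewrite big_mkord.
  apply: measurable_sum => i; apply: measurable_funM => //; exact: mgG.
have SA : <<s G >> (S @^-1` A).
  by rewrite -[X in <<s _ >> X]setTI; exact: mS.
have fD := fine_ge0 (measure_ge0 P (g k @^-1` B)).
have PDE : (fine (P (g k @^-1` B)))%:E = P (g k @^-1` B).
  by rewrite fineK// fin_num_measure//; exact: mg.
suff h C : <<s G >> C -> mrestr P (mg k B mB) C = mscale (NngNum fD) P C.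
  by have := h _ SA; rewrite /mrestr /mscale /= => ->; rewrite PDE muleC.
apply: (g_sigma_algebra_measure_unique G Gm (fun=> setT)) => //.
- by rewrite bigcup_const//; exists 0%N.
- move=> _ [{}C mC <-].
  change (P (cyl C `&` g k @^-1` B) =
    ((fine (P (g k @^-1` B)))%:E * P (cyl C))%E); rewrite PDE /cyl.
  (* Independence is used twice, for the first [k + 1] sides of [C'] and for the first [k] sides of
     [C]; the two products differ by the factor of [B]. *)
  pose C' i := if i == k then B else C i.
  have mC' i : measurable (C' i) by rewrite /C'; case: ifP.
  have := indep (index_iota 0 k.+1) C' (iota_uniq _ _) mC'.
  have := indep (index_iota 0 k) C (iota_uniq _ _) mC.
  rewrite !big_nat_recr//=.
  have E : \big[setI/[set: T]]_(0 <= i < k) g i @^-1` C' i =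
           \big[setI/[set: T]]_(0 <= i < k) g i @^-1` C i.
    by apply: eq_big_nat => i /andP[_ ik]; rewrite /C' ltn_eqF.
  have E2 : (\prod_(0 <= i < k) P (g i @^-1` C' i) =
             \prod_(0 <= i < k) P (g i @^-1` C i))%E.
    by apply: eq_big_nat => i /andP[_ ik]; rewrite /C' ltn_eqF.
  by rewrite E E2 /C' eqxx => -> ->; rewrite muleC.
- move=> _; change (P (setT `&` g k @^-1` B) < +oo)%E.
  by rewrite setTI ltey_eq fin_num_measure//; exact: mg.
Qed.

Lemma ge0_integral_identically_distributed (g : nat -> {RV P >-> R}) k
    (f : R -> \bar R) :
  identically_distributed P (fun i => g i : T -> R) ->
  measurable_fun setT f -> (forall x, 0 <= f x)%E ->
  (\int[P]_w f (g k w) = \int[P]_w f (g 0%N w))%E.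
Proof.
move=> id mf f0.
have h i : (\int[P]_w f (g i w) = \int[distribution P (g i)]_x f x)%E.
  by rewrite ge0_integral_pushforward.
rewrite !h; apply: eq_measure_integral => A mA _; exact: id.
Qed.

End independence.

(** * One replacement step in Lindeberg's argument *)

Section lindeberg_step.
Context {d} {T : measurableType d} {R : realType} (P : probability T R).

Lemma integrable_Phi (f : T -> R) : measurable_fun setT f ->
  P.-integrable setT (EFin \o (fun w => Phi (f w))).
Proof.
move=> mf; apply: measurable_bounded_integrable => //.
- by rewrite ltey_eq fin_num_measure.
- by apply: measurableT_comp => //; exact: measurable_Phi.
- exists 1; split => // M M1 w _ /=.
  by rewrite ger0_norm ?Phi_ge0// (le_trans (Phi_le1 _))// ltW.
Qed.

(** A continuous variant of Lindeberg's truncated second moment: the factor [min 1 (c |Y|)] comes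
    from the Taylor remainder and replaces the indicator of large [|Y|]. *)
Definition truncated_moment (Y : T -> R) (c : R) : R :=
  \int[P]_w (Y w ^+ 2 * Num.min 1 (c * `|Y w|)).

(** The cost of one replacement per unit of [a ^+ 2], for weights at most [m] and times at least
    [s]. The constants 4 and 17 are those of [Phi_taylor] and [Phi_scale_taylor]. *)
Definition lindeberg_error (Y : T -> R) (s m : R) : R :=
  (4 * truncated_moment Y (m / Num.sqrt s) + 17 * (m ^+ 2 / s)) / s.

Variable Y : {RV P >-> R}.
Hypothesis iY : P.-integrable setT (EFin \o Y).
Hypothesis iY2 : P.-integrable setT (EFin \o (fun w => Y w ^+ 2)).

Lemma truncated_moment_integrable c : 0 <= c ->
  P.-integrable setT (EFin \o (fun w => Y w ^+ 2 * Num.min 1 (c * `|Y w|))).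
Proof.
move=> c0; apply: le_integrable iY2 => //.
  apply/measurable_EFinP; apply: measurable_funM.
    exact: measurable_funX.
  apply: measurable_minr => //; apply: measurable_funM => //.
  exact: measurableT_comp.
move=> w _ /=; rewrite lee_fin normrM ler_piMr//.
by rewrite ger0_norm ?ge_min ?lexx// le_min ler01 mulr_ge0.
Qed.

Lemma truncated_moment_le c c' : 0 <= c -> c <= c' ->
  truncated_moment Y c <= truncated_moment Y c'.
Proof.
move=> c0 cc'; apply: le_Rintegral => //.
- exact: truncated_moment_integrable.
- by apply: truncated_moment_integrable; exact: le_trans cc'.
- move=> w _; rewrite ler_wpM2l ?sqr_ge0// le_min !ge_min lexx/=.
  by rewrite ler_wpM2r ?orbT.
Qed.

(** Dominated convergence along [c = 1 / (n + 1)], with [Y ^+ 2] as the dominating function. *)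
Lemma truncated_moment_cvg0 (e : R) : 0 < e ->
  exists2 c, 0 < c & truncated_moment Y c < e.
Proof.
move=> e0.
pose f n w := (Y w ^+ 2 * Num.min 1 (n.+1%:R^-1 * `|Y w|))%:E.
have [|||||_ _] := @dominated_convergence _ T R P setT measurableT f
   (cst 0%E) (EFin \o (fun w => Y w ^+ 2)).
- move=> n; have n0 : 0 <= n.+1%:R^-1 :> R by rewrite invr_ge0.
  by have /integrableP[] := truncated_moment_integrable _ n0.
- exact: measurable_cst.
- apply: aeW => w _ /=; rewrite /f; apply/cvg_EFin; first exact: nearW.
  rewrite [X in _ --> X](_ : _ = Y w ^+ 2 * 0); last by rewrite mulr0.
  apply: cvgM; first exact: cvg_cst.
  have : (n.+1%:R^-1 * `|Y w|) @[n --> \oo] --> (0 : R).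
    rewrite [X in _ --> X](_ : _ = 0 * `|Y w|); last by rewrite mul0r.
    apply: cvgM; [exact: cvg_harmonic|exact: cvg_cst].
  apply: squeeze_cvgr; last exact: cvg_cst.
  by apply: nearW => n; rewrite le_min ler01 mulr_ge0//= ge_min lexx orbT.
- exact: iY2.
- apply: aeW => w n _; rewrite /f /= lee_fin normrM ger0_norm ?sqr_ge0//.
  rewrite ler_piMr ?sqr_ge0// ger0_norm ?ge_min ?lexx//.
rewrite integral_cst// mul0e => /fine_cvgP[_ /cvgrPdist_lt /(_ e e0)].
move=> [N _ /(_ N (leqnn N))] /=; rewrite sub0r normrN => h.
by exists N.+1%:R^-1 => //; apply: le_lt_trans h; exact: ler_norm.
Qed.

Hypothesis EY : \int[P]_w Y w = 0.
Hypothesis EY2 : \int[P]_w (Y w ^+ 2) = 1.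

Let integrable_lin (A B C : R) :
  P.-integrable setT (EFin \o (fun w => A + (B * Y w + C * Y w ^+ 2))).
Proof.
have h1 := finite_measure_integrable_cst P A measurableT.
have h2 := integrableZl measurableT B iY.
have h3 := integrableZl measurableT C iY2.
exact: (integrableD measurableT h1 (integrableD measurableT h2 h3)).
Qed.

Let Rintegral_lin (A B C : R) :
  \int[P]_w (A + (B * Y w + C * Y w ^+ 2)) = A + C.
Proof.
have h1 := finite_measure_integrable_cst P A measurableT.
have h2 := integrableZl measurableT B iY.
have h3 := integrableZl measurableT C iY2.
rewrite (RintegralD measurableT h1 (integrableD measurableT h2 h3)).
rewrite (RintegralD measurableT h2 h3).
rewrite !RintegralZl// EY EY2 mulr0 add0r mulr1 Rintegral_cst//.
rewrite [X in fine X](_ : _ = 1%E); last exact: probability_setT.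
by rewrite mulr1.
Qed.

(** Since [Y] has mean 0 and second moment 1, both quantities have the same expansion to second
    order in [a], so only remainders are left. The bounds [s0] and [m] make the error factor common
    to all steps of the telescope. *)
Lemma lindeberg_step (r x a s s0 m : R) : 0 < s0 -> s0 <= s -> `|a| <= m ->
  `|\int[P]_w Phi ((r - (x + a * Y w)) / Num.sqrt s)
     - Phi ((r - x) / Num.sqrt (s + a ^+ 2))| <=
  a ^+ 2 * lindeberg_error Y s0 m.
Proof.
move=> s00 s0s am.
have s_gt0 : 0 < s by exact: lt_le_trans s0s.
have m0 : 0 <= m by apply: le_trans am.
have q0 : 0 < Num.sqrt s by rewrite sqrtr_gt0.
(* In these variables adding [a * Y] to [x] shifts [y] by [b * Y], while raising [s] by [a ^+ 2]
   divides [y] by the root of [1 + v], with [v = b ^+ 2]. *)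
pose y := (r - x) / Num.sqrt s.
pose b := - (a / Num.sqrt s).
pose v := a ^+ 2 / s.
have bv : b ^+ 2 = v by rewrite sqrrN expr_div_n sqr_sqrtr ?ltW.
have v0 : 0 <= v by rewrite divr_ge0 ?sqr_ge0 ?ltW.
have -> : (r - x) / Num.sqrt (s + a ^+ 2) = y / Num.sqrt (1 + v).
  have -> : s + a ^+ 2 = s * (1 + v).
    by rewrite mulrDr mulr1 /v mulrCA divff ?mulr1// gt_eqF.
  by rewrite sqrtrM ?ltW// invfM mulrA.
under eq_Rintegral => w _.
  rewrite (_ : (r - (x + a * Y w)) / Num.sqrt s = y + b * Y w); last first.
    by rewrite /y /b; field; rewrite gt_eqF.
  over.
have mu_ : measurable_fun setT (fun w => y + b * Y w).
  by apply: measurable_funD => //; exact: measurable_funM.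
have iu := integrable_Phi _ mu_.
pose c := m / Num.sqrt s0.
have c0 : 0 <= c by rewrite divr_ge0 ?sqrtr_ge0.
have H1 : `|\int[P]_w Phi (y + b * Y w) - Phi y + y * gauss y / 2 * v| <=
          4 * v * truncated_moment Y c.
  have iB := integrableB measurableT iu
    (integrable_lin (Phi y) (gauss y * b) (- (y * gauss y / 2 * v))).
  (* The constants are written as the expectation of the quadratic Taylor polynomial in [Y], so that
     the pointwise remainder can be integrated. *)
  have -> : \int[P]_w Phi (y + b * Y w) - Phi y + y * gauss y / 2 * v =
    \int[P]_w (Phi (y + b * Y w) - (Phi y + (gauss y * b * Y w
        + (- (y * gauss y / 2 * v)) * Y w ^+ 2))).
    by rewrite RintegralB// Rintegral_lin; ring.
  apply: le_trans (le_normr_Rintegral measurableT iB) _.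
  rewrite /truncated_moment -RintegralZl//; last exact: truncated_moment_integrable.
  apply: le_Rintegral => //.
  - exact: (integrable_abse iB).
  - exact: (integrableZl measurableT _ (truncated_moment_integrable _ c0)).
  move=> w _; have := Phi_taylor y (b * Y w).
  rewrite exprMn bv => h.
  rewrite [leLHS](_ : _ = `|Phi (y + b * Y w) - Phi y - gauss y * (b * Y w)
    + y * gauss y / 2 * (v * Y w ^+ 2)|); last by congr (`|_|); ring.
  apply: le_trans h _; rewrite -[leRHS]mulrA ler_wpM2l// -[leLHS]mulrA ler_wpM2l//.
  rewrite ler_wpM2l ?sqr_ge0// le_min !ge_min lexx/=.
  rewrite normrM ler_wpM2r ?orbT// normrN normrM normfV.
  rewrite (gtr0_norm q0) /c ler_pM ?invr_ge0//.
  by rewrite lef_pV2 ?posrE ?sqrtr_gt0// ler_wsqrtr.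
have H2 := Phi_scale_taylor y v v0.
set I := (\int[P]_w _)%R in H1 *.
have -> : I - Phi (y / Num.sqrt (1 + v)) =
  (I - Phi y + y * gauss y / 2 * v) -
  (Phi (y / Num.sqrt (1 + v)) - Phi y + y * gauss y / 2 * v) by ring.
apply: le_trans (ler_normB _ _) _.
apply: le_trans (lerD H1 H2) _.
rewrite /lindeberg_error -/c.
set K := truncated_moment Y c.
have K0 : 0 <= K.
  by apply: Rintegral_ge0 => w _; rewrite mulr_ge0 ?sqr_ge0// le_min ler01 mulr_ge0.
have vs0 : v <= a ^+ 2 / s0.
  by rewrite /v ler_wpM2l ?sqr_ge0// lef_pV2 ?posrE.
have am2 : a ^+ 2 <= m ^+ 2.
  by rewrite -real_normK ?num_real// lerXn2r// nnegrE.
have vm : v <= m ^+ 2 / s0.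
  by apply: le_trans vs0 _; apply: ler_wpM2r am2; rewrite invr_ge0 ltW.
have -> : a ^+ 2 * ((4 * K + 17 * (m ^+ 2 / s0)) / s0) =
  4 * (a ^+ 2 / s0) * K + 17 * (a ^+ 2 / s0 * (m ^+ 2 / s0)) by ring.
apply: lerD; first by rewrite ler_wpM2r// ler_wpM2l.
by rewrite ler_wpM2l// expr2 ler_pM.
Qed.

End lindeberg_step.

(** * The central limit theorem for weighted sums *)

Lemma measurable_sublevel {d} {T : measurableType d} {R : realType}
    (S : T -> R) (r : R) :
  measurable_fun setT S -> measurable [set w | S w <= r].
Proof.
move=> mS; rewrite (_ : [set w | S w <= r] = setT `&` S @^-1` [set` `]-oo, r]]).
  by apply: mS => //; exact: measurable_itv.
by rewrite setTI; apply/seteqP; split => w /=; rewrite in_itv.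
Qed.

Section clt.
Context {d} {T : measurableType d} {R : realType} (P : probability T R).
Variable g : nat -> {RV P >-> R}.
Hypothesis indep : mutually_independent P (fun i => g i : T -> R).
Hypothesis id_dist : identically_distributed P (fun i => g i : T -> R).
Hypothesis iY : P.-integrable setT (EFin \o g 0).
Hypothesis iY2 : P.-integrable setT (EFin \o (fun w => g 0 w ^+ 2)).
Hypothesis EY : \int[P]_w g 0 w = 0.
Hypothesis EY2 : \int[P]_w (g 0 w ^+ 2) = 1.

Lemma measurable_weighted_sum (a : nat -> R) k :
  measurable_fun setT (fun w => \sum_(0 <= i < k) a i * g i w).
Proof.
under eq_fun do rewrite big_mkord.
by apply: measurable_sum => i; exact: measurable_funM.
Qed.

Lemma Rintegral_Phi_last (a : nat -> R) k (r s : R) :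
  let S w := \sum_(0 <= i < k) a i * g i w in
  let J x := \int[P]_v Phi ((r - (x + a k * g 0 v)) / s) in
  \int[P]_w Phi ((r - \sum_(0 <= i < k.+1) a i * g i w) / s) =
    \int[P]_w J (S w) /\
  P.-integrable setT (EFin \o (fun w => J (S w))).
Proof.
move=> S J.
have mS : measurable_fun setT S by exact: measurable_weighted_sum.
have maff : measurable_fun setT
    (fun z : R * R => (r - (z.1 + a k * z.2)) / s).
  apply: measurable_funM => //; apply: measurable_funB => //.
  by apply: measurable_funD => //; exact: measurable_funM.
pose F (z : R * R) := (Phi ((r - (z.1 + a k * z.2)) / s))%:E.
have mF : measurable_fun setT F.
  apply/measurable_EFinP; apply: measurableT_comp maff; exact: measurable_Phi.
have F0 z : (0 <= F z)%E by rewrite lee_fin Phi_ge0.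
have JE x : (J x)%:E = (\int[P]_v F (x, g 0 v))%E.
  rewrite fineK//; apply: integrable_fin_num => //.
  apply: (integrable_Phi P (fun v => (r - (x + a k * g 0 v)) / s)).
  apply: measurable_funM => //; apply: measurable_funB => //.
  by apply: measurable_funD => //; exact: measurable_funM.
have J0 x : 0 <= J x by apply: Rintegral_ge0 => v _; exact: Phi_ge0.
have J1 x : J x <= 1.
  rewrite -lee_fin JE.
  rewrite (@le_trans _ _ (\int[P]_v (cst 1%E v))%E)//.
    apply: ge0_le_integral => //.
    - by apply: measurableT_comp mF _; exact: measurable_fun_pair.
    - by move=> v _; rewrite lee_fin Phi_le1.
  by rewrite integral_cst// mul1e probability_le1.
have mJ : measurable_fun setT J.
  apply/measurable_EFinP.
  (* Measurability of [J] is inherited from Tonelli, [J] being a partial integral of [F] against the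
     law of [g 0]. *)
  rewrite (_ : EFin \o J = fubini_F (distribution P (g 0)) F); last first.
    apply/funext => x; rewrite /= JE /fubini_F ge0_integral_pushforward//.
    by apply: measurableT_comp mF _; exact: measurable_pair1.
  exact: measurable_fun_fubini_tonelli_F.
split.
  pose Sm := mfun_Sub (mem_set mS : S \in mfun).
  congr fine; under eq_integral => w _ do rewrite big_nat_recr//=.
  have := ge0_integral_independent P Sm (g k) F _ mF F0.
  move=> -> /=; last by move=> A B mA mB; exact: independent_sum.
  apply: eq_integral => w _; rewrite JE.
  apply: (ge0_integral_identically_distributed P g k (fun y => F (S w, y))) => //.
  by apply: measurableT_comp mF _; exact: measurable_pair1.
apply: measurable_bounded_integrable.
- exact: measurableT.
- by rewrite ltey_eq fin_num_measure.
- exact: measurableT_comp mS.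
- exists 1; split => // M M1 w _ /=.
  by rewrite ger0_norm// (le_trans (J1 _))// ltW.
Qed.

(* Removing the last summand [a k * g k] costs [lindeberg_step] and moves the
   time from [s] to [s + a k ^+ 2], which is why [s] is generalised. *)
Lemma lindeberg_telescope (a : nat -> R) k (r s s0 m : R) :
  0 < s0 -> s0 <= s -> (forall i, (i < k)%N -> `|a i| <= m) ->
  `|\int[P]_w Phi ((r - \sum_(0 <= i < k) a i * g i w) / Num.sqrt s)
    - Phi (r / Num.sqrt (s + \sum_(0 <= i < k) a i ^+ 2))| <=
  (\sum_(0 <= i < k) a i ^+ 2) * lindeberg_error P (g 0) s0 m.
Proof.
move=> s00; elim: k s => [|k IH] s s0s am.
  rewrite !big_geq// addr0 mul0r.
  under eq_Rintegral do rewrite big_geq// subr0.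
  rewrite Rintegral_cst// [X in fine X](_ : _ = 1%E); last exact: probability_setT.
  by rewrite mulr1 subrr normr0.
have [-> iJ] := Rintegral_Phi_last a k r (Num.sqrt s).
have {IH} IH := IH (s + a k ^+ 2) (ler_wpDr (sqr_ge0 _) s0s)
  (fun i ik => am i (ltnW ik)).
rewrite !big_nat_recr//=.
rewrite -addrA [a k ^+ 2 + _]addrC in IH.
set S := (fun w => \sum_(0 <= i < k) a i * g i w) in iJ *.
set V := \sum_(0 <= i < k) a i ^+ 2 in IH *.
set q := Num.sqrt (s + a k ^+ 2) in IH.
set A := (X in `|X - _|); set A' := (X in `|X - _|) in IH.
have mq : measurable_fun setT (fun w => (r - S w) / q).
  apply: measurable_funM => //; apply: measurable_funB => //.
  exact: measurable_weighted_sum.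
have iq := integrable_Phi P _ mq.
have AA' : `|A - A'| <= a k ^+ 2 * lindeberg_error P (g 0) s0 m.
  rewrite /A /A' -RintegralB//.
  apply: le_trans (le_normr_Rintegral measurableT (integrableB measurableT iJ iq)) _.
  set E := _ * _.
  rewrite (_ : E = \int[P]_w cst E w); last first.
    rewrite Rintegral_cst// [X in fine X](_ : _ = 1%E) ?mulr1//.
    exact: probability_setT.
  apply: le_Rintegral => //.
  - exact: (integrable_abse (integrableB measurableT iJ iq)).
  - exact: finite_measure_integrable_cst.
  by move=> w _; apply: lindeberg_step => //; exact: am.
rewrite mulrDl [leRHS]addrC.
have -> : A - Phi (r / Num.sqrt (s + (V + a k ^+ 2))) =
  (A - A') + (A' - Phi (r / Num.sqrt (s + (V + a k ^+ 2)))) by ring.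
by apply: le_trans (ler_normD _ _) _; exact: lerD.
Qed.

Lemma lindeberg_error_small (s e : R) : 0 < s -> 0 < e ->
  exists2 m, 0 < m & lindeberg_error P (g 0) s m <= e.
Proof.
move=> s0 e0.
(* Each of the two terms of the error gets [e * s / 2]: [4 / 8] for the truncated moment, [17 / 34]
   for the term in [m ^+ 2]. *)
have [c c0 kc] := truncated_moment_cvg0 P (g 0) iY2 (e * s / 8)
  (divr_gt0 (mulr_gt0 e0 s0) (ltr0n _ 8)).
have q0 : 0 < Num.sqrt s by rewrite sqrtr_gt0.
have t0 : 0 < e * s ^+ 2 / 34 by rewrite divr_gt0// mulr_gt0// exprn_gt0.
pose m := Num.min (c * Num.sqrt s) (Num.sqrt (e * s ^+ 2 / 34)).
have m0 : 0 < m by rewrite lt_min mulr_gt0//= sqrtr_gt0.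
exists m => //.
have mc : m / Num.sqrt s <= c by rewrite ler_pdivrMr// ge_min lexx.
have m2 : m ^+ 2 <= e * s ^+ 2 / 34.
  rewrite -[leRHS]sqr_sqrtr ?(ltW t0)// lerXn2r ?nnegrE ?sqrtr_ge0 ?(ltW m0)//.
  by rewrite ge_min lexx orbT.
have km : truncated_moment P (g 0) (m / Num.sqrt s) <= e * s / 8.
  apply: le_trans (ltW kc); apply: truncated_moment_le => //.
  by rewrite divr_ge0 ?ltW.
have ms : m ^+ 2 / s <= e * s / 34.
  rewrite ler_pdivrMr//; apply: le_trans m2 _.
  by rewrite expr2 le_eqVlt; apply/orP; left; apply/eqP; ring.
rewrite /lindeberg_error ler_pdivrMr//; lra.
Qed.

(* Pointwise, the indicator of [x <= r] lies between
   [Phi ((r - eta - x) / q) - Phi (- eta / q)] and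
   [Phi ((r + eta - x) / q) + (1 - Phi (eta / q))]. *)
Lemma smoothed_indicator_sandwich (S : T -> R) (r eta q : R) :
  measurable_fun setT S -> 0 <= eta -> 0 < q ->
  \int[P]_w Phi ((r - eta - S w) / q) - Phi (- eta / q) <=
    fine (P [set w | S w <= r]) <=
  \int[P]_w Phi ((r + eta - S w) / q) + (1 - Phi (eta / q)).
Proof.
move=> mS eta0 q0.
pose A := [set w | S w <= r].
have mA : measurable A by exact: (measurable_sublevel S r mS).
have PA : fine (P A) = \int[P]_w (\1_A w : R).
  by rewrite /Rintegral integral_indic// setIT.
have iA : P.-integrable setT (EFin \o (\1_A : T -> R)).
  by apply: integrable_indic => //; rewrite ltey_eq fin_num_measure.
have mPhi r' : P.-integrable setT (EFin \o (fun w => Phi ((r' - S w) / q))).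
  apply: integrable_Phi; apply: measurable_funM => //.
  exact: measurable_funB.
have cstE c : \int[P]_w (cst c w) = c :> R.
  rewrite Rintegral_cst// [X in fine X](_ : _ = 1%E) ?mulr1//.
  exact: probability_setT.
have icst c := finite_measure_integrable_cst P c measurableT.
have qle x y : x <= y -> Phi (x / q) <= Phi (y / q).
  by move=> xy; apply: Phi_nondecreasing; rewrite ler_wpM2r ?invr_ge0 ?(ltW q0).
rewrite -/A PA; apply/andP; split.
  rewrite -[X in _ - X]cstE -RintegralB//.
  apply: le_Rintegral => //; first exact: (integrableB measurableT (mPhi _) (icst _)).
  move=> w _; rewrite indicE; have [wA|wA] := boolP (w \in A); rewrite /=.
    rewrite lerBlDr; apply: le_trans (Phi_le1 _) _.
    by rewrite lerDl Phi_ge0.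
  rewrite subr_le0; apply: qle.
  by move: wA; rewrite notin_setE /A /= => /negP; rewrite -ltNge; lra.
rewrite -[X in _ <= _ + X]cstE -RintegralD//.
apply: le_Rintegral => //; first exact: (integrableD measurableT (mPhi _) (icst _)).
move=> w _; rewrite indicE; have [wA|wA] := boolP (w \in A); rewrite /=.
  rewrite addrCA lerDl subr_ge0; apply: qle.
  by move: wA; rewrite inE /A /=; lra.
by rewrite addr_ge0 ?Phi_ge0// subr_ge0 Phi_le1.
Qed.

Lemma Phi_scale_dist (x v : R) : 0 <= v <= 1 ->
  `|Phi (x / Num.sqrt (1 + v)) - Phi x| <= 18 * v.
Proof.
move=> /andP[v0 v1].
have h := Phi_scale_taylor x v v0; have b := gauss_bound1 x.
have v2 : v ^+ 2 <= v by rewrite expr2 ler_piMr.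
have bv : `|x * gauss x / 2 * v| <= v.
  rewrite normrM (ger0_norm v0) ler_piMl// normrM (ger0_norm (_ : 0 <= 2^-1))//.
  lra.
rewrite [X in `|X|](_ : _ = (Phi (x / Num.sqrt (1 + v)) - Phi x
  + x * gauss x / 2 * v) - x * gauss x / 2 * v); last by ring.
apply: le_trans (ler_normB _ _) _; lra.
Qed.

(** The threshold [m] is chosen before [N] and [a]. This uniformity allows triangular arrays, as
    needed for regression weights that all change with the sample size. *)
Theorem weighted_clt (r e : R) : 0 < e ->
  exists2 m, 0 < m & forall N (a : nat -> R),
    \sum_(0 <= i < N) a i ^+ 2 = 1 -> (forall i, (i < N)%N -> `|a i| <= m) ->
    `|fine (P [set w | \sum_(0 <= i < N) a i * g i w <= r]) - Phi r| <= e.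
Proof.
move=> e0.
(* The budget: [e / 4] for moving [r] by [eta], [e / 2] for replacing the sum, [e / 4] for the tail
   of the smoothing. *)
have sandwich (p p1 p2 q q1 q2 t1 t2 : R) :
    `|q1 - q| <= e / 4 -> `|q2 - q| <= e / 4 ->
    `|p1 - q1| <= e / 2 -> `|p2 - q2| <= e / 2 ->
    1 - t1 <= e / 4 -> t2 <= e / 4 ->
    p2 - t2 <= p <= p1 + (1 - t1) -> `|p - q| <= e.
  rewrite !ler_norml => /andP[? ?] /andP[? ?] /andP[? ?] /andP[? ?] ? ?.
  by move=> /andP[? ?]; apply/andP; split; lra.
have e4 : 0 < e / 4 by rewrite divr_gt0.
have /cvgrPdist_le /(_ _ e4) /nbhs_ballP[h0 /= h00 hball] := continuous_Phi r.
pose eta := h0 / 2.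
have eta0 : 0 < eta by rewrite divr_gt0.
have eta1 : `|Phi (r + eta) - Phi r| <= e / 4.
  rewrite distrC; apply: hball; rewrite /ball /= opprD addrA subrr sub0r normrN.
  by rewrite gtr0_norm// /eta; lra.
have eta2 : `|Phi (r - eta) - Phi r| <= e / 4.
  rewrite distrC; apply: hball; rewrite /ball /= opprB addrCA subrr addr0.
  by rewrite gtr0_norm// /eta; lra.
have /cvgrPdist_le /(_ _ e4) [M1 [_ hM1]] := @cvg_Phiy R.
have /cvgrPdist_le /(_ _ e4) [M2 [_ hM2]] := @cvg_PhiNy R.
(* The added 1 turns the strict bounds of the limits at infinity into weak ones. *)
pose M := Num.max 1 (Num.max (M1 + 1) (1 - M2)).
have M0 : 0 < M by rewrite lt_max ltr01.
have M1M : M1 + 1 <= M by rewrite !le_max lexx !orbT.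
have M2M : 1 - M2 <= M by rewrite !le_max lexx !orbT.
(* Here [s] is the squared smoothing width. The first two bounds give [18 * s <= e / 4] in
   [Phi_scale_dist]; the third puts [eta / sqrt s] beyond [M], where the tails are small. *)
pose s := Num.min (Num.min 1 (e / 72)) ((eta / M) ^+ 2).
have s_gt0 : 0 < s by rewrite !lt_min ltr01 exprn_gt0 !divr_gt0.
have s1 : s <= 1 by rewrite !ge_min lexx.
have se : s <= e / 72 by rewrite !ge_min lexx orbT.
have q0 : 0 < Num.sqrt s by rewrite sqrtr_gt0.
have Mq : M <= eta / Num.sqrt s.
  rewrite ler_pdivlMr// mulrC -ler_pdivlMr//.
  have et : 0 <= eta / M by rewrite divr_ge0 ?ltW.
  rewrite -[leRHS](ger0_norm et) -sqrtr_sqr ler_wsqrtr//.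
  by rewrite !ge_min lexx orbT.
have tail1 : 1 - Phi (eta / Num.sqrt s) <= e / 4.
  apply: le_trans (ler_norm _) _; apply: hM1; lra.
have tail2 : Phi (- eta / Num.sqrt s) <= e / 4.
  have -> : Phi (- eta / Num.sqrt s) = `|0 - Phi (- eta / Num.sqrt s)|.
    by rewrite sub0r normrN ger0_norm ?Phi_ge0.
  apply: hM2; rewrite mulNr; lra.
have [m m0 hm] := lindeberg_error_small s (e / 4) s_gt0 e4.
exists m => // N a a1 am.
(* The telescope starts at time [s] and ends at [s + 1], the squares of the weights summing to 1;
   [Phi_scale_dist] then removes the extra [s]. *)
have tel r' : `|\int[P]_w Phi ((r' - \sum_(0 <= i < N) a i * g i w) / Num.sqrt s)
    - Phi r'| <= e / 2.
  have := lindeberg_telescope a N r' s s m s_gt0 (lexx s) am.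
  rewrite a1 mul1r [s + 1]addrC => /le_trans /(_ hm) h1.
  have s01 : 0 <= s <= 1 by rewrite s1 ltW.
  have h2 := Phi_scale_dist r' s s01.
  rewrite -(subrKA (Phi (r' / Num.sqrt (1 + s)))).
  have -> : e / 2 = e / 4 + e / 4 by field.
  apply: le_trans (ler_normD _ _) (lerD h1 (le_trans h2 _)).
  by rewrite mulrC -ler_pdivlMr// -mulrA -invfM -natrM.
apply: (sandwich _ _ _ _ _ _ _ _ eta1 eta2 (tel _) (tel _) tail1 tail2).
exact: smoothed_indicator_sandwich (measurable_weighted_sum a N) (ltW eta0) q0.
Qed.

End clt.

(** * Algebra of the design matrix and leverage of its rows *)

Section design.
Context {R : realType}.
Implicit Types (d n : nat) (x : nat -> R).

(** Entry [i] of the design matrix times [u], extended to all natural [i] to fit the sums over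
    natural numbers in [weighted_clt]. *)
Definition design_row d x (u : 'cV[R]_(d.+2)) (i : nat) : R :=
  u (inord (i %% d.+1)) 0 + u ord_max 0 * x (i %/ d.+1)%N.+1.

Lemma design_matrix_mulE d n x (u : 'cV[R]_(d.+2)) (i : 'I_(n * d.+1)) :
  (design_matrix d n x *m u) i 0 = design_row d x u i.
Proof.
rewrite mxE big_ord_recr /= mxE /= ltnn [X in _ + X]mulrC /design_row.
congr (_ + _).
have im : (i %% d.+1 < d.+1)%N by rewrite ltn_mod.
rewrite (bigD1 (Ordinal im))//= mxE /= im eqxx mul1r big1 ?addr0.
  by congr (u _ 0); apply/val_inj; rewrite /= inordK// ltnS ltnW.
move=> c ci; rewrite mxE /= ltn_ord.
by rewrite (_ : _ == _ = false) ?mul0r//; apply/negbTE: ci.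
Qed.

Lemma obs_vectorE {T : Type} d n x (beta : 'cV[R]_(d.+2)) (sigma : R)
    (gamma : nat -> T -> R) (w : T) :
  obs_vector d n x beta sigma gamma w =
  design_matrix d n x *m beta + sigma *: \col_i gamma i w.
Proof.
apply/matrixP => i j; rewrite ord1 [LHS]mxE [RHS]mxE design_matrix_mulE.
by rewrite !mxE.
Qed.

(** Centring the points at their mean kills the cross term. *)
Lemma sum_sqr_affine x n (b c : R) : (0 < n)%N ->
  \sum_(1 <= j < n.+1) (b + c * x j) ^+ 2 =
  n%:R * ((b + c * emp_mean x n) ^+ 2 + c ^+ 2 * emp_var x n).
Proof.
move=> n0; have n0' : n%:R != 0 :> R by rewrite pnatr_eq0 -lt0n.
set m := emp_mean x n.
have sx : \sum_(1 <= j < n.+1) (x j - m) = 0.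
  rewrite sumrB big_const_nat subSS subn0 iter_addr_0 /m /emp_mean.
  by rewrite -[X in _ - X]mulr_natl mulrA divff// mul1r subrr.
rewrite (eq_bigr (fun j => (b + c * m) ^+ 2 + (c ^+ 2 * (x j - m) ^+ 2
    + 2 * c * (b + c * m) * (x j - m)))); last by move=> j _; ring.
rewrite !big_split /= -[X in _ + (_ + X)]mulr_sumr sx mulr0 addr0.
rewrite -[X in _ + X]mulr_sumr.
rewrite big_const_nat subSS subn0 iter_addr_0 -[X in X + _]mulr_natl mulrDr; congr (_ + _).
by rewrite /emp_var mulrCA (mulrA n%:R) divff// mul1r.
Qed.

Lemma sum_sqr_design_row d n x (u : 'cV[R]_(d.+2)) : (0 < n)%N ->
  \sum_(0 <= i < n * d.+1) design_row d x u i ^+ 2 =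
  \sum_(k < d.+1) n%:R * ((u (inord k) 0 + u ord_max 0 * emp_mean x n) ^+ 2
     + u ord_max 0 ^+ 2 * emp_var x n).
Proof.
move=> n0; rewrite big_nat_mul.
transitivity (\sum_(0 <= j < n) \sum_(k < d.+1)
    (u (inord k) 0 + u ord_max 0 * x j.+1) ^+ 2).
  apply: eq_bigr => j _.
  rewrite mulSn -{1}[(j * d.+1)%N]add0n big_addn addnK big_mkord.
  apply: eq_bigr => k _.
  by rewrite /design_row [(k + _)%N]addnC modnMDl modn_small// divnMDl// divn_small// addn0.
rewrite exchange_big /=; apply: eq_bigr => k _.
by rewrite -sum_sqr_affine// big_add1.
Qed.

(** A single block already controls the slope and one centred intercept. Both the leverage bound and
    the invertibility of the Gram matrix rest on this. *)
Lemma sum_sqr_design_row_ge d n x (u : 'cV[R]_(d.+2)) k : (0 < n)%N -> (k < d.+1)%N ->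
  n%:R * ((u (inord k) 0 + u ord_max 0 * emp_mean x n) ^+ 2
     + u ord_max 0 ^+ 2 * emp_var x n) <=
  \sum_(0 <= i < n * d.+1) design_row d x u i ^+ 2.
Proof.
move=> n0 kd; rewrite sum_sqr_design_row// (bigD1 (Ordinal kd))//= lerDl.
apply: sumr_ge0 => j _; rewrite mulr_ge0// addr_ge0 ?sqr_ge0// mulr_ge0 ?sqr_ge0//.
by rewrite mulr_ge0// ?invr_ge0// sumr_ge0// => i _; rewrite sqr_ge0.
Qed.

(** Row [i] is the centred intercept of its block plus the slope times a deviation of size at most
    [D], and the block bounds both coefficients. As [u] is arbitrary, the inverse Gram matrix never
    has to be computed. *)
Lemma design_row_leverage d n x (u : 'cV[R]_(d.+2)) (D : R) i :
  0 < emp_var x n -> (i < n * d.+1)%N ->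
  (forall j, (1 <= j <= n)%N -> `|x j - emp_mean x n| <= D) ->
  design_row d x u i ^+ 2 <= 2 * (1 + D ^+ 2 / emp_var x n) / n%:R *
    \sum_(0 <= i < n * d.+1) design_row d x u i ^+ 2.
Proof.
move=> V0 iN xD.
have n0 : (0 < n)%N by move: iN; case: n {V0 xD}.
have kd : (i %% d.+1 < d.+1)%N by rewrite ltn_mod.
have := sum_sqr_design_row_ge d n x u _ n0 kd.
set Q := \sum_(0 <= _ < _) _.
have jn : (1 <= (i %/ d.+1).+1 <= n)%N by rewrite /= ltn_divLR.
have := xD _ jn; rewrite /design_row; set xj := x _.
set m := emp_mean x n; set V := emp_var x n in V0 *; set c := u ord_max 0.
set b := u _ 0 => xjD QB.
have nR : 0 < n%:R :> R by rewrite ltr0n.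
pose Bc := (b + c * m) ^+ 2.
have Bc0 : 0 <= Bc by exact: sqr_ge0.
have D2 : (xj - m) ^+ 2 <= D ^+ 2.
  by rewrite -(real_normK (num_real (xj - m))) lerXn2r ?nnegrE// (le_trans _ xjD).
have D20 : 0 <= D ^+ 2 by exact: sqr_ge0.
have cV : Bc + c ^+ 2 * V <= Q / n%:R by rewrite ler_pdivlMr// mulrC.
have c20 : 0 <= c ^+ 2 by exact: sqr_ge0.
have cV2 : c ^+ 2 <= Q / n%:R / V by rewrite ler_pdivlMr//; lra.
have cVp : 0 <= c ^+ 2 * V by rewrite mulr_ge0// ltW.
have BQ : Bc <= Q / n%:R by lra.
have -> : 2 * (1 + D ^+ 2 / V) / n%:R * Q =
   2 * (Q / n%:R) + 2 * (Q / n%:R / V * D ^+ 2) by ring.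
have -> : b + c * xj = (b + c * m) + c * (xj - m) by ring.
(* The inequality [(p + q)^2 <= 2 p^2 + 2 q^2], from the square of [p - q] being nonnegative. *)
apply: le_trans (_ : 2 * Bc + 2 * (c ^+ 2 * (xj - m) ^+ 2) <= _).
  rewrite /Bc; have := sqr_ge0 ((b + c * m) - c * (xj - m)); nra.
apply: lerD; first by rewrite ler_wpM2l.
by rewrite ler_wpM2l// ler_pM ?sqr_ge0.
Qed.

(** A kernel vector [u] satisfies [|X u|^2 = 0]. Positive variance forces its slope to vanish, and
    then every intercept. *)
Lemma gram_unit d n x : 0 < emp_var x n ->
  (design_matrix d n x)^T *m design_matrix d n x \in unitmx.
Proof.
move=> V0; set X := design_matrix d n x.
(* For [n = 0] the inverse of 0 is 0, so the variance would vanish. *)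
have n0 : (0 < n)%N.
  by move: V0; case: n {X} => //; rewrite /emp_var invr0 mul0r ltxx.
rewrite -unitmx_tr -row_free_unit -kermx_eq0; apply/eqP/row_matrixP => i.
rewrite row0; set r := row i _.
have rM : r *m (X^T *m X)^T = 0.
  by apply/sub_kermxP; exact: row_sub.
pose u := r^T.
have Q0 : \sum_(0 <= i < n * d.+1) design_row d x u i ^+ 2 = 0.
  have : (r *m (X^T *m X)^T *m u) 0 0 = 0 by rewrite rM mul0mx mxE.
  rewrite trmx_mul trmxK mulmxA -mulmxA.
  have -> : r *m X^T = (X *m u)^T by rewrite trmx_mul trmxK.
  rewrite mxE => E; rewrite -[RHS]E big_mkord; apply: eq_bigr => j _.
  by rewrite mxE design_matrix_mulE expr2.
have key k : (k < d.+1)%N ->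
    u (inord k) 0 + u ord_max 0 * emp_mean x n = 0 /\ u ord_max 0 = 0.
  move=> kd; have := sum_sqr_design_row_ge d n x u k n0 kd.
  rewrite Q0 pmulr_rle0 ?ltr0n// => h.
  have h1 := sqr_ge0 (u (inord k) 0 + u ord_max 0 * emp_mean x n).
  have h2 : 0 <= u ord_max 0 ^+ 2 * emp_var x n by rewrite mulr_ge0 ?sqr_ge0 ?ltW.
  split; first by apply/eqP; rewrite -sqrf_eq0 eq_le h1 andbT; lra.
  have /eqP : u ord_max 0 ^+ 2 * emp_var x n = 0 by lra.
  by rewrite mulf_eq0 (gt_eqF V0) orbF sqrf_eq0 => /eqP.
have us : u ord_max 0 = 0 by have [] := key 0%N isT.
suff u0 : u = 0 by rewrite -[r]trmxK -/u u0 trmx0.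
apply/matrixP => k j; rewrite ord1 [RHS]mxE.
have [kd|] := ltnP k d.+1.
  have [] := key k kd; rewrite us mul0r addr0 => + _.
  by rewrite inord_val.
move=> dk; rewrite (_ : k = ord_max)//; apply: val_inj => /=.
by apply/eqP; rewrite eqn_leq dk andbT -ltnS ltn_ord.
Qed.

(** With [u = M^-1 t] the quadratic form under the root is [|X u|^2] and the numerator is [sigma]
    times the inner product of [X u] with the errors, so [sigma] cancels. *)
Lemma std_stat_weightedE {T : Type} d n x (beta : 'cV[R]_(d.+2)) (sigma : R)
    (gamma : nat -> T -> R) (t : 'cV[R]_(d.+2)) :
  0 < emp_var x n -> 0 < sigma -> t != 0 ->
  exists u : 'cV[R]_(d.+2),
    let Q := \sum_(0 <= i < n * d.+1) design_row d x u i ^+ 2 in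
    0 < Q /\
    forall w, std_stat d n x beta sigma gamma t w =
      \sum_(0 <= i < n * d.+1) design_row d x u i / Num.sqrt Q * gamma i w.
Proof.
move=> V0 sigma0 t0.
have Mu := gram_unit d n x V0.
set X := design_matrix d n x in Mu; set M := X^T *m X in Mu.
have MT : M^T = M by rewrite trmx_mul trmxK.
pose u := invmx M *m t; exists u => Q.
have uT : u^T = t^T *m invmx M by rewrite trmx_mul trmx_inv MT.
have qE : (t^T *m invmx M *m t) 0 0 = Q.
  have -> : t^T *m invmx M *m t = (X *m u)^T *m (X *m u).
    by rewrite trmx_mul uT -mulmxA -(mulmxA _ X^T) (mulmxA X^T) -/M mulKVmx// mulmxA.
  rewrite mxE /Q big_mkord; apply: eq_bigr => j _.
  by rewrite mxE design_matrix_mulE expr2.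
have Q0 : 0 < Q.
  rewrite lt_def sumr_ge0 ?andbT; last by move=> i _; exact: sqr_ge0.
  (* If [X u] vanished, so would [t = X^T X u]. *)
  apply: contra t0 => /eqP Q0.
  have Xu0 : X *m u = 0.
    apply/matrixP => i j; rewrite ord1 design_matrix_mulE mxE.
    apply/eqP; rewrite -sqrf_eq0; apply/eqP.
    move: Q0; rewrite /Q big_mkord => /eqP.
    rewrite psumr_eq0; last by move=> k _; exact: sqr_ge0.
    by move=> /allP /(_ i); rewrite mem_index_enum => /(_ isT)/eqP.
  by rewrite -(mulKVmx Mu t) -/u /M -mulmxA Xu0 mulmx0.
split => // w.
have lseE : lse d n x beta sigma gamma w - beta =
    sigma *: (invmx M *m X^T *m \col_i gamma i w).
  rewrite /lse -/X -/M obs_vectorE -/X mulmxDr -scalemxAr.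
  rewrite (_ : _ *m (X *m beta) = beta) ?[beta + _]addrC ?addrK//.
  by rewrite -mulmxA (mulmxA X^T) mulKmx.
rewrite /std_stat -/X -/M qE lseE -scalemxAr mxE invfM.
have -> : t^T *m (invmx M *m X^T *m \col_i gamma i w) =
  (X *m u)^T *m \col_i gamma i w by rewrite trmx_mul uT !mulmxA.
rewrite [sigma * _]mulrC -mulrA (mulrA sigma) divff ?gt_eqF// mul1r.
rewrite mxE mulr_suml big_mkord; apply: eq_bigr => i _.
by rewrite mxE design_matrix_mulE mxE mulrAC.
Qed.

End design.

(** * Growth rates and vanishing leverage *)

Section asymptotics.
Context {R : realType}.
Implicit Types (x : nat -> R).

Lemma emp_mean_dist x n (B : R) j : (1 <= j <= n)%N ->
  (forall j, (1 <= j <= n)%N -> `|x j| <= B) ->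
  `|x j - emp_mean x n| <= 2 * B.
Proof.
move=> jn xB; have n0 : (0 < n)%N by case/andP: jn => ?; exact: leq_trans.
rewrite mulr_natl mulr2n; apply: le_trans (ler_normB _ _) _.
apply: lerD; first exact: xB.
rewrite /emp_mean normrM ger0_norm ?invr_ge0// mulrC ler_pdivrMr ?ltr0n//.
apply: le_trans (ler_norm_sum _ _ _) _.
have -> : B * n%:R = \sum_(1 <= i < n.+1) B.
  by rewrite sumr_const_nat subSS subn0 mulr_natr.
rewrite big_nat_cond [leRHS]big_nat_cond; apply: ler_sum => i.
by rewrite andbT ltnS; exact: xB.
Qed.

Lemma powR_growth_bound x (C mu : R) N : 0 <= mu ->
  (forall n, (N <= n)%N -> `|x n| <= C * n%:R `^ mu) ->
  exists2 C', 0 <= C' & forall n j, (1 <= j <= n)%N -> `|x j| <= C' * n%:R `^ mu.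
Proof.
move=> mu0 xC; pose K := \sum_(0 <= j < N) `|x j|.
have K0 : 0 <= K by apply: sumr_ge0.
exists (`|C| + K) => [|n j /andP[j1 jn]]; first by rewrite addr_ge0.
have n1 : 1 <= n%:R `^ mu.
  by rewrite -[leLHS](powRr0 n%:R) ler_powR// ler1n (leq_trans j1).
have [Nj|jN] := leqP N j.
  apply: le_trans (xC _ Nj) _.
  apply: le_trans (_ : `|C| * j%:R `^ mu <= _).
    by rewrite ler_wpM2r ?powR_ge0 ?ler_norm.
  rewrite ler_pM ?powR_ge0 ?lerDl//.
  by rewrite ge0_ler_powR ?nnegrE// ler_nat.
apply: le_trans (_ : K <= _).
  rewrite /K (bigD1_seq j) ?iota_uniq ?mem_index_iota//= lerDl.
  by apply: sumr_ge0.
apply: le_trans (_ : K * n%:R `^ mu <= _); first by rewrite ler_peMr.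
by rewrite ler_wpM2r ?powR_ge0// lerDr.
Qed.

Lemma natr_powR_large (p A : R) : 0 < p ->
  exists N, forall n, (N <= n)%N -> A <= n%:R `^ p.
Proof.
move=> p0; pose B := Num.max 0 A.
exists (Num.bound (B `^ p^-1)) => n Nn.
have B0 : 0 <= B by rewrite le_max lexx.
apply: le_trans (_ : B <= _); first by rewrite le_max lexx orbT.
rewrite -[leLHS](powRr1 B0) -[X in B `^ X](mulVf (lt0r_neq0 p0)) powRrM.
rewrite ge0_ler_powR ?nnegrE ?powR_ge0// ?(ltW p0)//.
apply: le_trans (_ : (Num.bound (B `^ p^-1))%:R <= _); last by rewrite ler_nat.
by apply: ltW; apply: archi_boundP; exact: powR_ge0.
Qed.

(** Since [g] is nonnegative, the variance stays above [c]; deviations from the mean are of order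
    [n^(mu/2)]. The leverage is then of order [n^(mu - 1)], which vanishes as [mu < 1]. *)
Lemma leverage_cvg0 x (g mu c C e : R) N1 N2 :
  0 <= g -> 0 <= mu -> mu < 1 -> 0 < c -> 0 < e ->
  (forall n, (N1 <= n)%N -> c * n%:R `^ g <= emp_var x n) ->
  (forall n, (N2 <= n)%N -> `|x n| <= C * n%:R `^ (mu / 2)) ->
  exists N, forall n, (N <= n)%N -> 0 < emp_var x n /\
    exists2 D, forall j, (1 <= j <= n)%N -> `|x j - emp_mean x n| <= D &
      2 * (1 + D ^+ 2 / emp_var x n) / n%:R <= e.
Proof.
move=> g0 mu0 mu1 c0 e0 xV xC.
have mu20 : 0 <= mu / 2 by rewrite divr_ge0.
have [C' C'0 xC'] := powR_growth_bound x C (mu / 2) N2 mu20 xC.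
(* With [D = 2 C' n^(mu/2)] and variance at least [c], the numerator is at most [K n^mu]; it remains
   to have [K / e <= n^(1 - mu)]. *)
pose K := 2 * (1 + 4 * C' ^+ 2 / c).
have [N3 hN3] := natr_powR_large (1 - mu) (K / e) (ltac:(by rewrite subr_gt0)).
exists (maxn 1 (maxn N1 N3)) => n; rewrite !geq_max => /and3P[n1 n2 n3].
have n1R : 1 <= n%:R :> R by rewrite ler1n.
have nR0 : 0 < n%:R :> R by rewrite ltr0n.
have cV : c <= emp_var x n.
  apply: le_trans (xV n n2); rewrite ler_peMr ?(ltW c0)//.
  by rewrite -[leLHS](powRr0 n%:R) ler_powR.
have V0 : 0 < emp_var x n by exact: lt_le_trans cV.
split=> //; exists (2 * (C' * n%:R `^ (mu / 2))).
  by move=> j jn; apply: emp_mean_dist => // i; exact: xC'.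
have pm : (n%:R `^ (mu / 2)) ^+ 2 = n%:R `^ mu :> R.
  by rewrite -powR_mulrn ?powR_ge0// -powRrM; congr (_ `^ _); field.
have nmu1 : 1 <= n%:R `^ mu :> R.
  by rewrite -[leLHS](powRr0 n%:R) ler_powR.
have nmu0 : 0 < n%:R `^ mu :> R by exact: lt_le_trans nmu1.
rewrite !exprMn pm ler_pdivrMr//.
apply: le_trans (_ : K * n%:R `^ mu <= _).
  rewrite /K -mulrA ler_wpM2l// mulrDl mul1r lerD//.
  have -> : 2 ^+ 2 * (C' ^+ 2 * n%:R `^ mu) / emp_var x n =
    4 * C' ^+ 2 * n%:R `^ mu / emp_var x n by ring.
  rewrite [leRHS]mulrAC ler_wpM2l ?lef_pV2 ?posrE//.
  by rewrite !mulr_ge0 ?sqr_ge0 ?powR_ge0.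
have := hN3 n n3; rewrite powRB; last by rewrite (gt_eqF nR0) implybT.
rewrite powRr1 ?(ltW nR0)// ler_pdivrMr// mulrAC ler_pdivlMr//.
by rewrite [n%:R * e]mulrC.
Qed.

End asymptotics.

(** * Asymptotic normality of the least squares estimator *)

Theorem mainTheorem8 (R : realType) (d : nat) (dT : measure_display)
  (Omega : measurableType dT) (P : probability Omega R)
  (eps : nat -> R) (beta : 'cV[R]_(d.+2)) (sigma : R)
  (gamma : nat -> {RV P >-> R}) (g mu : R) :
  (0 < d)%N ->
  (forall j, (1 <= j)%N -> 0 < eps j) ->
  (forall j, (1 <= j)%N -> eps j.+1 < eps j) ->
  0 < sigma ->
  mutually_independent P (fun i => gamma i : Omega -> R) ->
  identically_distributed P (fun i => gamma i : Omega -> R) ->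
  (gamma 0%N : Omega -> R) \in Lfun P 2%:E ->
  ('E_P[gamma 0%N] = 0)%E ->
  ('V_P[gamma 0%N] = 1)%E ->
  0 <= g -> 0 <= mu -> Num.max mu (2 * mu - g) < 1 ->
  (exists c1 c2 : R, 0 < c1 /\ 0 < c2 /\ exists N : nat, forall n, (N <= n)%N ->
     c1 * n%:R `^ g <= emp_var (design_x eps) n <= c2 * n%:R `^ g) ->
  (exists C : R, exists N : nat, forall n, (N <= n)%N ->
     `|design_x eps n| <= C * n%:R `^ (mu / 2)) ->
  forall t : 'cV[R]_(d.+2), t != 0 ->
    cvg_dist_std_normal P
      (fun n => std_stat d n (design_x eps) beta sigma
                  (fun i => gamma i : Omega -> R) t).
Proof.
move=> _ _ _ sigma0 indep ident L2 E0 V1 g0 mu0.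
rewrite gt_max => /andP[mu1 _] [c1 [c2 [c10 [_ [N1 xV]]]]] [C [N2 xC]] t t0 r.
have iY2 := Lfun2_integrable_sqr L2.
have L1 : (gamma 0%N : Omega -> R) \in Lfun P 1.
  by apply: Lfun_subset12 L2; rewrite fin_num_measure.
have iY : P.-integrable setT (EFin \o gamma 0) by exact/Lfun1_integrable.
have EY : \int[P]_w gamma 0 w = 0.
  by move: E0; rewrite expectation_def /Rintegral => ->.
have EY2 : \int[P]_w (gamma 0 w ^+ 2) = 1.
  move: V1; rewrite varianceE// E0 expe2 mule0 sube0 unlock => h.
  by rewrite /Rintegral h.
have {}xV n : (N1 <= n)%N -> c1 * n%:R `^ g <= emp_var (design_x eps) n.
  by move=> /xV /andP[].
rewrite -PhiE.
(* Puts the statistic, for large [n], in the form required by [weighted_clt]. *)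
have lin m : 0 < m -> exists N, forall n, (N <= n)%N ->
    exists2 a : nat -> R,
      \sum_(0 <= i < n * d.+1) a i ^+ 2 = 1 /\
      (forall i, (i < n * d.+1)%N -> `|a i| <= m) &
    forall w, std_stat d n (design_x eps) beta sigma
      (fun i => gamma i : Omega -> R) t w =
      \sum_(0 <= i < n * d.+1) a i * gamma i w.
  move=> m0; have m20 : 0 < m ^+ 2 by rewrite exprn_gt0.
  (* The tolerance is [m ^+ 2] because the leverage bounds the squared weights. *)
  have [N hN] := leverage_cvg0 _ g mu c1 C _ N1 N2 g0 mu0 mu1 c10 m20 xV xC.
  exists N => n /hN[V0 [D xD De]].
  have [u [Q0 uE]] := std_stat_weightedE d n (design_x eps) beta sigma
     (fun i => gamma i : Omega -> R) t V0 sigma0 t0.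
  set Q := \sum_(0 <= _ < _) _ in Q0 uE.
  exists (fun i => design_row d (design_x eps) u i / Num.sqrt Q) => //.
  have aE i : (design_row d (design_x eps) u i / Num.sqrt Q) ^+ 2 =
      design_row d (design_x eps) u i ^+ 2 / Q.
    by rewrite expr_div_n sqr_sqrtr ?ltW.
  split.
    by under eq_bigr do rewrite aE; rewrite -mulr_suml divff ?gt_eqF.
  move=> i iN; rewrite -ler_sqr ?nnegrE ?(ltW m0)// real_normK ?num_real// aE.
  rewrite ler_pdivrMr//.
  apply: le_trans (design_row_leverage d n _ u D i V0 iN xD) _.
  by rewrite ler_wpM2r// ltW.
have mset n (a : nat -> R) :
    measurable [set w | \sum_(0 <= i < n * d.+1) a i * gamma i w <= r].
  exact: (measurable_sublevel _ r (measurable_weighted_sum P gamma a _)).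
(* Convergence in the extended reals also asks for eventually finite values. Finiteness is obtained
   from measurability through the weighted-sum form, here with the arbitrary threshold 1. *)
apply/fine_cvgP; split.
  have [N hN] := lin 1 ltr01.
  exists N => // n /hN[a _ aE] /=.
  by rewrite fin_num_measure//; under eq_set do rewrite aE.
apply/cvgrPdist_le => e e0.
have [m m0 hm] := weighted_clt P gamma indep ident iY iY2 EY EY2 r e e0.
have [N hN] := lin m m0.
exists N => // n /hN[a [a1 am] aE] /=.
by rewrite distrC; under eq_set do rewrite aE; exact: hm.
Qed.
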